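(* Let $F=u\,\phi(r,s)$ be a spherically symmetric Finsler surface (dimension $n=2$) on $\mathbb{B}^2(r_0)\subset\mathbb{R}^2$. At every $(x,y)$ with $x,y$ linearly independent, the main scalar $I$ of $F$ is given by $$I=\frac{\phi}{2}\left(\frac{3\mu}{a}\bigl((m^1)^2+(m^2)^2\bigr)-3a\mu\,(r^2-s^2)^2B^2+\frac{\nu}{a^3}\right),$$ where $B=\rho_2+s\rho_3$, $\mu=\phi\phi_s-s\phi_s^2-s\phi\phi_{ss}$, $\nu=3\phi_s\phi_{ss}+\phi\phi_{sss}$.
   Context: Notation: for $x\in\mathbb{B}^2(r_0)$ (the open disc of radius $r_0$ centred at $0$) and $y\in\mathbb{R}^2\setminus\{0\}$ put $r=|x|$, $u=|y|$, $s=\langle x,y\rangle/|y|$ (Euclidean norm and inner product). Subscripts $s$ denote partial derivatives. Indices of $x$ and $y$ are lowered with the Kronecker delta: $x_i=x^i$, $y_i=y^i$. Summation over repeated indices. A spherically symmetric Finsler metric is $F=u\,\phi(r,s)$ with $\phi$ positive and smooth (for $|s|\le r<r_0$), and, in dimension 2, regular: $\phi-s\phi_s+(r^2-s^2)\phi_{ss}>0$ for all $|s|\le r<r_0$. Its metric tensor is $g_{ij}=\frac12\frac{\partial^2F^2}{\partial y^i\partial y^j}$ with inverse $g^{ij}$; its Cartan tensor is $C_{ijk}=\frac12\frac{\partial g_{ij}}{\partial y^k}$. Set $n_i=x_i-\frac{s}{u}y_i$, $\mathbf{n}^i=x^i-\frac{s}{u}y^i$, and $$\rho_0=\frac{1}{\phi(\phi-s\phi_s)},\quad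 \rho_2=-\frac{\phi\phi_s-s\phi_s^2-s\phi\phi_{ss}}{\phi^2(\phi-s\phi_s)(\phi-s\phi_s+(r^2-s^2)\phi_{ss})},\quad \rho_3=-\frac{\phi_{ss}}{\phi(\phi-s\phi_s)(\phi-s\phi_s+(r^2-s^2)\phi_{ss})},$$ $$a=\sqrt{\frac{\phi\,(\phi-s\phi_s+(r^2-s^2)\phi_{ss})}{r^2-s^2}}.$$ The Berwald frame is $(\ell^i,m^i)$ with $\ell^i=y^i/F$, $m_i=a\,n_i$ and $$m^i=g^{ij}m_j=a\Bigl(\rho_0\,\mathbf{n}^i+\frac{r^2-s^2}{u}(\rho_2\,y^i+u\rho_3\,x^i)\Bigr),\quad i=1,2.$$ The main scalar $I(x,y)$ is defined by $F\,C_{ijk}=I\,m_im_jm_k$, equivalently $I=F\,C_{ijk}m^im^jm^k$. In the claim, $(m^1)^2+(m^2)^2$ is the sum of squares of the two components of $m^i$. *)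

(* Defs.v *)
From mathcomp Require Import all_boot all_order all_algebra.
From mathcomp Require Import all_classical all_reals all_analysis.

Set Implicit Arguments.
Unset Strict Implicit.
Unset Printing Implicit Defensive.

Import Order.TTheory GRing.Theory Num.Theory.
Import numFieldNormedType.Exports.
Local Open Scope classical_set_scope.
Local Open Scope ring_scope.

(* The library's norm on 'rV[R]_n is the sup norm, hence the explicit
   Euclidean inner product and norm. *)
Definition dot (R : realType) (n : nat) (x y : 'rV[R]_n) : R :=
  \sum_(i < n) x 0 i * y 0 i.

Definition enorm (R : realType) (n : nat) (x : 'rV[R]_n) : R :=
  Num.sqrt (dot x x).

(* Functions of class C^k on an open subset U of the plane. *)
Fixpoint C_k_on (R : realType) (k : nat) (U : set (R * R)) (f : R -> R -> R)
    : Prop :=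
  (forall p, U p -> {for p, continuous (fun q : R * R => f q.1 q.2)}) /\
  (if k is k'.+1 then
     (forall p, U p ->
        derivable (f^~ p.2) p.1 1 /\ derivable (f p.1) p.2 1) /\
     C_k_on k' U (fun r s => derive1 (f^~ s) r) /\
     C_k_on k' U (fun r s => derive1 (f r) s)
   else True).

(* Smoothness on an arbitrary subset A of the plane means smoothness on some
   open neighbourhood of A. *)
Definition smooth_on (R : realType) (A : set (R * R)) (f : R -> R -> R)
    : Prop :=
  exists U : set (R * R),
    [/\ open U, A `<=` U & forall k, C_k_on k U f].

(** Finsler quantities of an arbitrary F(x, y), x and y in R^n; all
    derivatives are taken in the variable y. *)

Definition d_y (R : realType) (n : nat) (i : 'I_n) (f : 'rV[R]_n -> R)
    (y : 'rV[R]_n) : R :=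
  'D_(delta_mx 0 i) f y.

Definition metric_tensor (R : realType) (n : nat)
    (F : 'rV[R]_n -> 'rV[R]_n -> R) (x y : 'rV[R]_n) : 'M[R]_n :=
  \matrix_(i, j) (2^-1 * d_y j (d_y i (fun z => F x z ^+ 2)) y).

Definition cartan_tensor (R : realType) (n : nat)
    (F : 'rV[R]_n -> 'rV[R]_n -> R) (x y : 'rV[R]_n) (i j k : 'I_n) : R :=
  2^-1 * d_y k (fun z => metric_tensor F x z i j) y.

Definition raise_index (R : realType) (n : nat)
    (F : 'rV[R]_n -> 'rV[R]_n -> R) (x y : 'rV[R]_n) (w : 'I_n -> R)
    (i : 'I_n) : R :=
  \sum_(j < n) invmx (metric_tensor F x y) i j * w j.

(** Spherically symmetric metrics u phi(r, s). *)

Definition phi_s (R : realType) (phi : R -> R -> R) (r s : R) : R :=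
  derive1 (phi r) s.
Definition phi_ss (R : realType) (phi : R -> R -> R) (r s : R) : R :=
  derive1n 2 (phi r) s.
Definition phi_sss (R : realType) (phi : R -> R -> R) (r s : R) : R :=
  derive1n 3 (phi r) s.

Definition regularity_term (R : realType) (phi : R -> R -> R) (r s : R) : R :=
  phi r s - s * phi_s phi r s + (r ^+ 2 - s ^+ 2) * phi_ss phi r s.

Definition rs_domain (R : realType) (r0 : R) : set (R * R) :=
  [set p | `|p.2| <= p.1 /\ p.1 < r0].

(* phi defines a spherically symmetric Finsler surface on the disc of radius
   r0; the regularity condition is the two-dimensional one. *)
Record spherically_symmetric_surface (R : realType) (r0 : R)
    (phi : R -> R -> R) : Prop := SphericallySymmetricSurface {
  radius_gt0 : 0 < r0;
  phi_smooth : smooth_on (rs_domain r0) phi;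
  phi_gt0 : forall r s, `|s| <= r -> r < r0 -> 0 < phi r s;
  phi_regular : forall r s, `|s| <= r -> r < r0 -> 0 < regularity_term phi r s
}.

Definition s_of (R : realType) (n : nat) (x y : 'rV[R]_n) : R :=
  dot x y / enorm y.

Definition spherical_metric (R : realType) (n : nat) (phi : R -> R -> R)
    (x y : 'rV[R]_n) : R :=
  enorm y * phi (enorm x) (s_of x y).

Definition rho2 (R : realType) (phi : R -> R -> R) (r s : R) : R :=
  - ((phi r s * phi_s phi r s - s * phi_s phi r s ^+ 2
      - s * phi r s * phi_ss phi r s)
     / (phi r s ^+ 2 * (phi r s - s * phi_s phi r s)
        * regularity_term phi r s)).

Definition rho3 (R : realType) (phi : R -> R -> R) (r s : R) : R :=
  - (phi_ss phi r s
     / (phi r s * (phi r s - s * phi_s phi r s) * regularity_term phi r s)).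

Definition frame_coef (R : realType) (phi : R -> R -> R) (r s : R) : R :=
  Num.sqrt (phi r s * regularity_term phi r s / (r ^+ 2 - s ^+ 2)).

Definition n_covec (R : realType) (n : nat) (x y : 'rV[R]_n) (i : 'I_n) : R :=
  x 0 i - s_of x y / enorm y * y 0 i.

Definition m_covec (R : realType) (phi : R -> R -> R) (x y : 'rV[R]_2)
    (i : 'I_2) : R :=
  frame_coef phi (enorm x) (s_of x y) * n_covec x y i.

Definition m_vec (R : realType) (phi : R -> R -> R) (x y : 'rV[R]_2)
    (i : 'I_2) : R :=
  raise_index (spherical_metric phi) x y (m_covec phi x y) i.

Definition is_main_scalar (R : realType) (phi : R -> R -> R) (x y : 'rV[R]_2)
    (I : R) : Prop :=
  forall i j k : 'I_2,
    spherical_metric phi x y * cartan_tensor (spherical_metric phi) x y i j k =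
    I * m_covec phi x y i * m_covec phi x y j * m_covec phi x y k.

(* Main.v *)
(* In the Euclidean orthonormal frame (y/u, n/sqrt N), where N = r^2 - s^2,
   the third derivative of F^2 = u^2 phi^2 in y reduces to
   C_ijk = (nu + 3 mu / N) / (2 u) n_i n_j n_k, so that
   I = phi / (2 a^3) (nu + 3 mu / N).  In the same frame the metric has
   determinant phi^3 T, T the regularity term, and
   m^i = a / (phi^2 T) (phi n_i - phi_s N y_i / u), whence
   |m|^2 = a^2 N^2 B^2 + 1 / (N a^2) because a^2 N = phi T and
   B = - phi_s / (phi^2 T); this rewrites I in the stated form.
   The denominators of rho_2 and rho_3 contain phi - s phi_s, whose
   positivity follows from the two-dimensional regularity condition. *)

Require Import Defs.
From mathcomp Require Import all_boot all_order all_algebra.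
From mathcomp Require Import all_classical all_reals all_analysis.
From mathcomp Require Import ring.

Set Implicit Arguments.
Unset Strict Implicit.
Unset Printing Implicit Defensive.

Import Order.TTheory GRing.Theory Num.Theory.
Import numFieldNormedType.Exports.
Local Open Scope ring_scope.

(** * Differentiation rules along a vector *)

Section DeriveRules.
Local Open Scope classical_set_scope.
Variables (R : realType) (V : normedModType R).
Implicit Types (f g : V -> R) (x v : V).

Lemma derive_line f x v : 'D_v f x = 'D_1 (fun h : R => f (h *: v + x)) 0.
Proof.
rewrite /derive; set p := fun h => h^-1 *: _; set q := fun h => h^-1 *: _.
suff -> : p = q by [].
by apply/funext => h; rewrite /p /q /= addr0 scale0r add0r [_%:A]mulr1.
Qed.

(** A derivative along [v] is an ordinary derivative at 0 on the line through [x]; this brings the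
    one-variable chain rule to functions of a vector. *)
Lemma is_derive_line f x v (df : R) :
  is_derive x v f df <-> is_derive (0 : R) 1 (fun h : R => f (h *: v + x)) df.
Proof.
split=> -[dfx <-]; apply: DeriveDef; rewrite ?derive_line//.
  exact: (derivable1P f x v).1.
exact: (derivable1P f x v).2.
Qed.

Lemma is_derive_compr (h : R -> R) g x v (dh dg : R) :
  is_derive (g x) 1 h dh -> is_derive x v g dg ->
  is_derive x v (fun z => h (g z)) (dh * dg).
Proof.
move=> hgx /is_derive_line gx; apply/is_derive_line.
by apply: (@is_derive1_comp _ h); rewrite ?scale0r ?add0r.
Qed.

(** This rule and the next ones use pointwise lambda terms, so that nested applications assemble the
    derivative of an explicit expression. *)
Lemma is_derive_addf f g x v (df dg : R) :
  is_derive x v f df -> is_derive x v g dg ->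
  is_derive x v (fun z => f z + g z) (df + dg).
Proof. exact: is_deriveD. Qed.

Lemma is_derive_oppf f x v (df : R) :
  is_derive x v f df -> is_derive x v (fun z => - f z) (- df).
Proof. exact: is_deriveN. Qed.

Lemma is_derive_mulf f g x v (df dg : R) :
  is_derive x v f df -> is_derive x v g dg ->
  is_derive x v (fun z => f z * g z) (f x * dg + g x * df).
Proof. exact: is_deriveM. Qed.

Lemma is_derive_invf f x v (df : R) :
  f x != 0 -> is_derive x v f df ->
  is_derive x v (fun z => (f z)^-1) (- df / f x ^+ 2).
Proof.
move=> fx0 [dfx <-]; apply: DeriveDef; first exact: derivableV.
by rewrite deriveV// mulrC /GRing.scale/= mulrN mulNr mulrC.
Qed.

Lemma is_derive_cstf (c : R) x v : is_derive x v (fun=> c) (0 : R).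
Proof. exact: is_derive_cst. Qed.

End DeriveRules.

(** * Euclidean norm, inner product and the variable [s] *)

Section Euclid.
Local Open Scope classical_set_scope.
Variables (R : realType) (n : nat).
Implicit Types x y v : 'rV[R]_n.

Lemma is_derive_coord x v i : is_derive x v (fun z => z 0 i) (v 0 i).
Proof.
apply: DeriveDef.
  by have /derivable_mxP := @derivable_id R 'rV[R]_n x v; apply.
have := derive_mx (@derivable_id R 'rV[R]_n x v).
by rewrite derive_id => /matrixP /(_ 0 i); rewrite mxE => /esym.
Qed.

Lemma is_derive_dot x y v : is_derive y v (dot x) (dot x v).
Proof.
rewrite [X in is_derive _ _ X _](_ : _ =
    \sum_(i < n) (fun z : 'rV[R]_n => x 0 i * z 0 i)); last first.
  by apply/funext => z; rewrite fct_sumE.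
rewrite /dot; apply: is_derive_sum => i.
apply: is_derive_eq; first
  exact: is_derive_mulf (is_derive_cstf _ _ _) (is_derive_coord _ _ _).
by rewrite mulr0 addr0.
Qed.

Lemma is_derive_sqnorm y v :
  is_derive y v (fun z => dot z z) (2 * dot y v).
Proof.
have -> : (fun z => dot z z) = \sum_(i < n) (fun z : 'rV[R]_n => z 0 i * z 0 i).
  by apply/funext => z; rewrite fct_sumE.
have -> : 2 * dot y v = \sum_(i < n) (y 0 i * v 0 i + y 0 i * v 0 i).
  by rewrite big_split /= -mulr2n mulr_natl.
apply: is_derive_sum => i.
exact: is_derive_mulf (is_derive_coord _ _ _) (is_derive_coord _ _ _).
Qed.

Lemma dot_ge0 y : 0 <= dot y y.
Proof. by apply: sumr_ge0 => i _; rewrite -expr2 sqr_ge0. Qed.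

Lemma dot_gt0 y : y != 0 -> 0 < dot y y.
Proof.
move=> y0; rewrite lt_def dot_ge0 andbT; apply: contra_neq y0 => dy0.
apply/rowP => i; rewrite mxE; apply/eqP; rewrite -sqrf_eq0 expr2.
move/eqP: dy0; rewrite psumr_eq0 => [/allP/(_ i)|j _].
  by rewrite mem_index_enum; apply.
by rewrite -expr2 sqr_ge0.
Qed.

Lemma enorm_gt0 y : y != 0 -> 0 < enorm y.
Proof. by move=> y0; rewrite sqrtr_gt0 dot_gt0. Qed.

Lemma sqr_enorm y : enorm y ^+ 2 = dot y y.
Proof. by rewrite sqr_sqrtr ?dot_ge0. Qed.

Lemma is_derive_enorm y v : y != 0 ->
  is_derive y v (@enorm R n) (dot y v / enorm y).
Proof.
move=> y0; apply: is_derive_eq.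
  exact: (@is_derive_compr _ _ Num.sqrt (fun z => dot z z) _ _ _ _
    (is_derive1_sqrt (dot_gt0 y0)) (is_derive_sqnorm y v)).
by rewrite -/(enorm y); have := enorm_gt0 y0; rewrite lt0r => /andP[? _]; field.
Qed.

Lemma is_derive_s_of x y v : y != 0 ->
  is_derive y v (s_of x) (dot x v / enorm y - s_of x y * dot y v / enorm y ^+ 2).
Proof.
move=> y0; have u0 : enorm y != 0 by rewrite gt_eqF ?enorm_gt0.
apply: is_derive_eq.
  exact: (is_derive_mulf (is_derive_dot x y v)
    (is_derive_invf u0 (is_derive_enorm v y0))).
by rewrite /s_of; field.
Qed.

(** The derivative formulas for [F ^+ 2] are proved away from the origin; this makes them equalities
    near [y], which is enough to differentiate again. *)
Lemma near_neq0 y : y != 0 -> \forall z \near y, z != 0.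
Proof.
move=> y0; apply: (@cvgr_neq0 _ _ _ (nbhs y) _ id y) => //; exact: cvg_id.
Qed.

Lemma dot_delta x i : dot x (delta_mx 0 i) = x 0 i.
Proof.
rewrite /dot (bigD1 i)//= big1 ?addr0 ?mxE ?eqxx ?mulr1// => j ji.
by rewrite mxE (negbTE ji) andbF mulr0.
Qed.

Lemma dotr0 x : dot x 0 = 0.
Proof. by rewrite /dot big1// => i _; rewrite mxE mulr0. Qed.

Lemma sqr_dot_le x y : dot x y ^+ 2 <= dot x x * dot y y.
Proof.
have [->|y0] := eqVneq y 0.
  by rewrite !dotr0 expr0n mulr0.
have yy := dot_gt0 y0.
(* Coefficient of the orthogonal projection of [x] on [y], which minimises the squared norm of
   [x - c *: y]. *)
pose c := dot x y / dot y y.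
have := dot_ge0 (x - c *: y).
have -> : dot (x - c *: y) (x - c *: y)
    = dot x x - 2 * c * dot x y + c ^+ 2 * dot y y.
  rewrite /dot !mulr_sumr -sumrB -big_split /=.
  by apply: eq_bigr => i _; rewrite !mxE; ring.
have -> : dot x x - 2 * c * dot x y + c ^+ 2 * dot y y
   = (dot x x * dot y y - dot x y ^+ 2) / dot y y.
  by rewrite /c; have /lt0r_neq0 yn0 := yy; field.
by rewrite pmulr_lge0 ?invr_gt0// subr_ge0.
Qed.

(** Cauchy-Schwarz. It keeps [(r, s)] in the region where [phi] is smooth, positive and regular. *)
Lemma s_of_le x y : `|s_of x y| <= enorm x.
Proof.
have [->|y0] := eqVneq y 0.
  by rewrite /s_of dotr0 mul0r normr0 sqrtr_ge0.
rewrite -ler_sqr ?nnegrE ?sqrtr_ge0// real_normK ?num_real// sqr_enorm.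
by rewrite /s_of expr_div_n sqr_enorm ler_pdivrMr ?dot_gt0 ?sqr_dot_le.
Qed.

End Euclid.

(** * Derivatives of [F ^+ 2] in [y] up to order three, in any dimension *)

Section SquaredMetric.
Local Open Scope classical_set_scope.
Variables (R : realType) (n : nat) (phi : R -> R -> R) (x : 'rV[R]_n).
Let r := enorm x.
Let p := phi r.
Let p1 := phi_s phi r.
Let p2 := phi_ss phi r.
Let p3 := phi_sss phi r.
Hypothesis dp : forall s : R, `|s| <= r -> is_derive s 1 p (p1 s).
Hypothesis dp1 : forall s : R, `|s| <= r -> is_derive s 1 p1 (p2 s).
Hypothesis dp2 : forall s : R, `|s| <= r -> is_derive s 1 p2 (p3 s).

(** [al] and [be] are the coefficients of [y] and [u x] in the gradient of [F ^+ 2]. The family is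
    closed under differentiation in [s] up to third order: [al' = 2 mu], [be' = de], [mu' = - s nu],
    [de' = 2 nu]. *)
Let al s := 2 * p s * (p s - s * p1 s).
Let be s := 2 * p s * p1 s.
Let mu s := p s * p1 s - s * p1 s ^+ 2 - s * p s * p2 s.
Let de s := 2 * (p1 s ^+ 2 + p s * p2 s).
Let nu s := 3 * p1 s * p2 s + p s * p3 s.

Let dal (s : R) : `|s| <= r -> is_derive s 1 al (2 * mu s).
Proof.
move=> sr; apply: is_derive_eq.
  exact: (is_derive_mulf (is_derive_mulf (is_derive_cstf 2 _ _) (dp sr))
    (is_derive_addf (dp sr)
      (is_derive_oppf (is_derive_mulf (is_derive_id s 1) (dp1 sr))))).
by rewrite /= /mu; ring.
Qed.

Let dbe (s : R) : `|s| <= r -> is_derive s 1 be (de s).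
Proof.
move=> sr; apply: is_derive_eq.
  exact: (is_derive_mulf (is_derive_mulf (is_derive_cstf 2 _ _) (dp sr)) (dp1 sr)).
by rewrite /= /de; ring.
Qed.

Let dmu (s : R) : `|s| <= r -> is_derive s 1 mu (- s * nu s).
Proof.
move=> sr; apply: is_derive_eq.
  exact: (is_derive_addf (is_derive_addf (is_derive_mulf (dp sr) (dp1 sr))
   (is_derive_oppf (is_derive_mulf (is_derive_id s 1)
     (is_derive_mulf (dp1 sr) (dp1 sr)))))
   (is_derive_oppf (is_derive_mulf
     (is_derive_mulf (is_derive_id s 1) (dp sr)) (dp2 sr)))).
by rewrite /= /nu; ring.
Qed.

Let dde (s : R) : `|s| <= r -> is_derive s 1 de (2 * nu s).
Proof.
move=> sr; apply: is_derive_eq.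
  exact: (is_derive_mulf (is_derive_cstf 2 _ _)
    (is_derive_addf (is_derive_mulf (dp1 sr) (dp1 sr))
      (is_derive_mulf (dp sr) (dp2 sr)))).
by rewrite /= /nu; ring.
Qed.

Let ds (i : 'I_n) (y : 'rV[R]_n) : y != 0 -> is_derive y (delta_mx 0 i) (s_of x)
  (x 0 i / enorm y - s_of x y * y 0 i / enorm y ^+ 2).
Proof.
by move=> y0; have := is_derive_s_of x (delta_mx 0 i) y0; rewrite !dot_delta.
Qed.

Let du (i : 'I_n) (y : 'rV[R]_n) : y != 0 ->
  is_derive y (delta_mx 0 i) (@enorm R n) (y 0 i / enorm y).
Proof.
by move=> y0; have := is_derive_enorm (delta_mx 0 i) y0; rewrite !dot_delta.
Qed.

Let dco (i j : 'I_n) (y : 'rV[R]_n) :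
  is_derive y (delta_mx 0 j) (fun z => z 0 i) ((i == j)%:R : R).
Proof. by have := is_derive_coord y (delta_mx 0 j) i; rewrite mxE eqxx. Qed.

Let F2 (z : 'rV[R]_n) : R := spherical_metric phi x z ^+ 2.

Lemma d_y_sqr_metric (i : 'I_n) (y : 'rV[R]_n) : y != 0 ->
  d_y i F2 y = y 0 i * al (s_of x y) + enorm y * be (s_of x y) * x 0 i.
Proof.
move=> y0; have u0 : enorm y != 0 by rewrite gt_eqF ?enorm_gt0.
have sr := s_of_le x y.
have df := is_derive_mulf (du i y0) (is_derive_compr (dp sr) (ds i y0)).
have := is_derive_mulf df df; rewrite /d_y => -[_].
have -> : F2 = (fun z => enorm z * p (s_of x z) * (enorm z * p (s_of x z))).
  by apply/funext => z; rewrite /F2 expr2.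
by move=> ->; rewrite /al /be; field.
Qed.

(** The Hessian as the product rule delivers it; its symmetry in [i] and [j] rests on
    [be - s de = 2 mu]. *)
Let g i j (y : 'rV[R]_n) := (i == j)%:R * al (s_of x y)
  + 2 * (y 0 i * mu (s_of x y))
      * (x 0 j / enorm y - s_of x y * y 0 j / enorm y / enorm y)
  + be (s_of x y) * x 0 i * (y 0 j / enorm y)
  + de (s_of x y) * x 0 i * (x 0 j - s_of x y * y 0 j / enorm y).

Lemma d_y2_sqr_metric (i j : 'I_n) (y : 'rV[R]_n) : y != 0 ->
  d_y j (d_y i F2) y = g i j y.
Proof.
move=> y0; have u0 : enorm y != 0 by rewrite gt_eqF ?enorm_gt0.
have sr := s_of_le x y.
rewrite /d_y; rewrite (@near_eq_derive _ _ _ _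
  (fun y : 'rV[R]_n =>
    y 0 i * al (s_of x y) + enorm y * be (s_of x y) * x 0 i)); last first.
  by near=> z; apply: d_y_sqr_metric; near: z; exact: near_neq0.
have [_] := is_derive_addf
  (is_derive_mulf (dco i j y) (is_derive_compr (dal sr) (ds j y0)))
  (is_derive_mulf (is_derive_mulf (du j y0) (is_derive_compr (dbe sr) (ds j y0)))
   (is_derive_cstf (x 0 i) _ _)).
by move=> ->; rewrite /g; field.
Unshelve. all: by end_near. Qed.

(** The result stays in expanded form; it collapses only in dimension two, once orthonormal
    coordinates are substituted. *)
Lemma is_derive_d_y2_sqr_metric (i j k : 'I_n) (y : 'rV[R]_n) : y != 0 ->
  let s := s_of x y in let u := enorm y in
  let sd l := x 0 l / u - s * y 0 l / u ^+ 2 in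
  is_derive y (delta_mx 0 k) (d_y j (d_y i F2))
  (2 * mu s * ((i == j)%:R * sd k + (i == k)%:R * sd j)
  - 2 * y 0 i * s * nu s * sd k * sd j
  + 2 * y 0 i * mu s * (- x 0 j * y 0 k / u ^+ 3 - sd k * y 0 j / u ^+ 2
      - s * (j == k)%:R / u ^+ 2 + 2 * s * y 0 j * y 0 k / u ^+ 4)
  + be s * x 0 i * ((j == k)%:R / u - y 0 j * y 0 k / u ^+ 3)
  + 2 * nu s * sd k * x 0 i * (x 0 j - s * y 0 j / u)
  + de s * x 0 i * (s * y 0 j * y 0 k / u ^+ 3 - s * (j == k)%:R / u)).
Proof.
move=> y0; have u0 : enorm y != 0 by rewrite gt_eqF ?enorm_gt0.
have sr := s_of_le x y.
move=> /=; apply: (@near_eq_is_derive _ _ _ (g i j)).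
  by near=> z; apply/esym/d_y2_sqr_metric; near: z; exact: near_neq0.
have dV := is_derive_invf u0 (du k y0).
have dX l := is_derive_cstf (x 0 l) y (delta_mx 0 k).
have dsy := is_derive_mulf (is_derive_mulf (ds k y0) (dco j k y)) dV.
apply: is_derive_eq; first exact: (is_derive_addf (is_derive_addf (is_derive_addf
  (is_derive_mulf (is_derive_cstf (i == j)%:R _ _)
    (is_derive_compr (dal sr) (ds k y0)))
  (is_derive_mulf
    (is_derive_mulf (is_derive_cstf 2 _ _)
      (is_derive_mulf (dco i k y) (is_derive_compr (dmu sr) (ds k y0))))
    (is_derive_addf (is_derive_mulf (dX j) dV)
      (is_derive_oppf (is_derive_mulf dsy dV)))))
  (is_derive_mulf (is_derive_mulf (is_derive_compr (dbe sr) (ds k y0)) (dX i))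
    (is_derive_mulf (dco j k y) dV)))
  (is_derive_mulf (is_derive_mulf (is_derive_compr (dde sr) (ds k y0)) (dX i))
    (is_derive_addf (dX j) (is_derive_oppf dsy)))).
by rewrite /=; field.
Unshelve. all: by end_near. Qed.

End SquaredMetric.

(** * Consequences of smoothness and regularity of [phi] *)

Section Surface.
Local Open Scope classical_set_scope.
Variables (R : realType) (r0 : R) (phi : R -> R -> R).
Hypothesis hphi : spherically_symmetric_surface r0 phi.

Lemma surface_is_derive (r s : R) : `|s| <= r -> r < r0 ->
  [/\ is_derive s 1 (phi r) (phi_s phi r s),
      is_derive s 1 (phi_s phi r) (phi_ss phi r s) &
      is_derive s 1 (phi_ss phi r) (phi_sss phi r s)].
Proof.
(* Class C^3 suffices: following the [s]-branch at each level gives derivability of [phi], [phi_s]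
   and [phi_ss] in turn. *)
move=> sr rr0; have [U [_ sU /(_ 3%N)[_ [d0 [_ [_ [d1 [_ [_ [d2 _]]]]]]]]]] :=
  phi_smooth hphi.
have Urs : U (r, s) by apply: sU.
have D (f : R -> R) : derivable f s 1 -> is_derive s 1 f (derive1 f s).
  by move=> df; rewrite derive1E; exact: derivableP.
have /= [_ /D e0] := d0 _ Urs; have /= [_ /D e1] := d1 _ Urs.
have /= [_ /D e2] := d2 _ Urs.
split; [exact: e0|exact: e1|exact: e2].
Qed.

(* At an interior minimum of [phi - s phi_s] in [s], either [s = 0] or
   [phi_ss = 0]; at an endpoint, [r^2 - s^2 = 0].  In the last two cases
   the minimum equals the regularity term. *)
Lemma surface_coef_gt0 (r s : R) : `|s| <= r -> r < r0 ->
  0 < phi r s - s * phi_s phi r s.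
Proof.
move=> sr rr0; have r_ge0 : 0 <= r := le_trans (normr_ge0 s) sr.
pose k t := phi r t - t * phi_s phi r t.
have dk (t : R) : `|t| <= r -> is_derive t 1 k (- (t * phi_ss phi r t)).
  move=> tr; have [dp dp1 _] := surface_is_derive tr rr0.
  by apply: is_derive_eq; rewrite /GRing.scale /=; ring.
have rr : - r <= r by rewrite ge0_cp.
have kc : {within `[- r, r], continuous k}.
  apply: derivable_within_continuous => t; rewrite in_itv /= -ler_norml.
  by move=> /dk[].
have [c] := EVT_min rr kc; rewrite in_itv /= => crr cmin.
have cr : `|c| <= r by rewrite ler_norml.
apply: lt_le_trans (_ : k c <= _); last first.
  by apply: cmin; rewrite in_itv /= -ler_norml.
have T0 := phi_regular hphi cr rr0; rewrite /regularity_term -/(k c) in T0.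
have [c0|c0] := eqVneq c 0.
  by rewrite /k c0 mul0r subr0; apply: phi_gt0 hphi _ _ _ rr0; rewrite normr0.
have [cE|cE] := eqVneq (r ^+ 2) (c ^+ 2).
  by move: T0; rewrite cE subrr mul0r addr0.
have cin : c \in `]- r, r[%R.
  rewrite in_itv /= -ltr_norml lt_neqAle cr andbT.
  by apply: contra_neq cE => <-; rewrite real_normK ?num_real.
have oc t : t \in `]- r, r[%R -> `|t| <= r.
  by rewrite in_itv /= -ltr_norml => /ltW.
have [_ k0] : is_derive c 1 k 0.
  apply: (derive1_at_min rr) => // t tin; first by have [] := dk t (oc t tin).
  by apply: cmin; move: (oc _ tin); rewrite ler_norml in_itv.
have [_] := dk c cr; rewrite k0 => /esym/eqP; rewrite oppr_eq0 mulf_eq0.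
by rewrite (negbTE c0) /= => /eqP pss; move: T0; rewrite pss mulr0 addr0.
Qed.

End Surface.

(** * Linear algebra in the plane and adapted coordinates *)

Section Plane.
Variables (R : realType).
Implicit Types x y : 'rV[R]_2.

Lemma det_mx2 (A : 'M[R]_2) : \det A = A 0 0 * A 1 1 - A 0 1 * A 1 0.
Proof.
rewrite (expand_det_row _ 0) big_ord_recl big_ord1 /cofactor !det_mx11 !mxE /=.
rewrite /bump /= !addn0 !add0n expr0 expr1 mul1r mulN1r mulrN.
by congr (A _ _ * A _ _ - A _ _ * A _ _); apply: val_inj.
Qed.

(** Lets a raised vector be verified by lowering its index again, so that no inverse matrix is
    computed. *)
Lemma raise_index_unique (F : 'rV[R]_2 -> 'rV[R]_2 -> R) x y
    (w v : 'I_2 -> R) i :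
  \det (metric_tensor F x y) != 0 ->
  (forall j, w j = \sum_(k < 2) metric_tensor F x y j k * v k) ->
  raise_index F x y w i = v i.
Proof.
set G := metric_tensor F x y; move=> G0 wE.
have uG : G \in unitmx by rewrite unitmxE unitfE.
pose V : 'cV_2 := \col_k v k; pose W : 'cV_2 := \col_k w k.
have WE : W = G *m V.
  by apply/colP => j; rewrite !mxE wE; apply: eq_bigr => k _; rewrite !mxE.
have -> : v i = (invmx G *m W) i 0 by rewrite WE mulKmx// mxE.
by rewrite mxE; apply: eq_bigr => k _; rewrite !mxE.
Qed.

Lemma dot2 x y : dot x y = x 0 0 * y 0 0 + x 0 1 * y 0 1.
Proof.
rewrite /dot big_ord_recl big_ord1; congr (_ + x 0 _ * y 0 _); exact: val_inj.
Qed.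

Lemma ord2P (P : 'I_2 -> Prop) : P 0 -> P 1 -> forall i, P i.
Proof.
move=> P0 P1; case=> -[|[|]]// h; [move: P0|move: P1];
  by congr P; apply: val_inj.
Qed.

Lemma free_cross x y : free [:: x; y] ->
  y != 0 /\ x 0 0 * y 0 1 - x 0 1 * y 0 0 != 0.
Proof.
rewrite free_cons seq1_free span_seq1 => /andP[xy y0]; split=> //.
(* If the cross product vanishes, [x] equals its orthogonal projection on the line of [y], which
   gives the scalar. *)
apply: contraNneq xy => /subr0_eq c0; apply/vlineP; exists (dot x y / dot y y).
have := dot_gt0 y0; rewrite !dot2 => /lt0r_neq0 d0.
apply/rowP; apply: ord2P; rewrite mxE; field: c0; exact: d0.
Qed.

End Plane.

(** Here [(c, d)] is the unit vector of [y], [(d, -c)] is orthogonal to it, and [w] is the signed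
    component of [x] along the latter, so that [n = w (d, -c)]. After substitution, tensor
    identities become rational identities modulo the single relation on [c] and [d], oriented for
    use by [field]. *)
Lemma orthonormal_coords (R : realType) (x y : 'rV[R]_2) : free [:: x; y] ->
  exists c d w : R,
  [/\ y 0 0 = enorm y * c /\ y 0 1 = enorm y * d, c ^+ 2 = 1 - d ^+ 2,
      x 0 0 = s_of x y * c + w * d /\ x 0 1 = s_of x y * d - w * c,
      w != 0 & enorm x ^+ 2 - s_of x y ^+ 2 = w ^+ 2].
Proof.
move=> /free_cross[y0 xy0]; have u0 : enorm y != 0 by rewrite gt_eqF ?enorm_gt0.
have u2 : enorm y ^+ 2 = y 0 0 ^+ 2 + y 0 1 ^+ 2 by rewrite sqr_enorm dot2.
exists (y 0 0 / enorm y), (y 0 1 / enorm y),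
  ((x 0 0 * y 0 1 - x 0 1 * y 0 0) / enorm y).
rewrite sqr_enorm /s_of !dot2.
split; [split; by field | | split | by rewrite mulf_neq0 ?invr_eq0 |];
  by field: u2; exact: u0.
Qed.

(** * Metric, Cartan tensor, Berwald frame and main scalar *)

Section MainScalar.
Variables (R : realType) (r0 : R) (phi : R -> R -> R).
Hypothesis hphi : spherically_symmetric_surface r0 phi.
Variables (x y : 'rV[R]_2).
Hypotheses (xr0 : enorm x < r0) (xy : free [:: x; y]).
Let F := @spherical_metric R 2 phi.
Let r := enorm x.
Let s := s_of x y.
Let u := enorm y.
Let p := phi r s.
Let p1 := phi_s phi r s.
Let p2 := phi_ss phi r s.
Let p3 := phi_sss phi r s.
Let N := r ^+ 2 - s ^+ 2.
Let mu := p * p1 - s * p1 ^+ 2 - s * p * p2.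
Let nu := 3 * p1 * p2 + p * p3.
Let T := regularity_term phi r s.
Let a := frame_coef phi r s.

Let dphi t : `|t| <= r -> _ := fun tr => surface_is_derive hphi tr xr0.
Let dp (t : R) (tr : `|t| <= r) : is_derive t 1 (phi r) (phi_s phi r t).
Proof. by have [] := dphi tr. Qed.
Let dp1 (t : R) (tr : `|t| <= r) : is_derive t 1 (phi_s phi r) (phi_ss phi r t).
Proof. by have [] := dphi tr. Qed.
Let dp2 (t : R) (tr : `|t| <= r) :
  is_derive t 1 (phi_ss phi r) (phi_sss phi r t).
Proof. by have [] := dphi tr. Qed.

Let y0 : y != 0. Proof. by have [] := free_cross xy. Qed.
Let u0 : u != 0. Proof. by rewrite gt_eqF ?enorm_gt0. Qed.

Lemma metric_tensorE (i j : 'I_2) : metric_tensor F x y i j =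
  (i == j)%:R * p * (p - s * p1)
  + y 0 i * mu * (x 0 j / u - s * y 0 j / u ^+ 2)
  + p * p1 * x 0 i * y 0 j / u
  + (p1 ^+ 2 + p * p2) * x 0 i * (x 0 j - s * y 0 j / u).
Proof.
rewrite mxE (d_y2_sqr_metric dp dp1) // -/r -/s -/u -/p -/p1 -/p2.
by rewrite /mu; field.
Qed.

(** By homogeneity the symmetric Cartan tensor annihilates [y], so in the plane it must be a
    multiple of the cube of [n]. *)
Lemma cartan_tensorE (i j k : 'I_2) : cartan_tensor F x y i j k =
  (nu + 3 * mu / N) / (2 * u) * n_covec x y i * n_covec x y j * n_covec x y k.
Proof.
have [c [d [w [[yc yd] cd [xc xd] w0 Nw]]]] := orthonormal_coords xy.
have dg := is_derive_d_y2_sqr_metric dp dp1 dp2 i j k y0.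
have [_] := is_derive_mulf (is_derive_cstf 2^-1 _ _) dg.
rewrite /cartan_tensor /d_y => gE.
under eq_fun do rewrite mxE.
rewrite gE -/r -/s -/u -/p -/p1 -/p2 -/p3 {gE dg}.
rewrite /n_covec /mu /nu /N Nw -/s -/u.
(* All eight components are checked in the coordinates [c], [d], [w]. *)
move: i j k; do 3! apply: ord2P;
  rewrite /= ?(xc, xd) ?(yc, yd) -/s -/u; field: cd; by rewrite ?w0 ?u0.
Qed.

Let p_gt0 : 0 < p. Proof. exact: (phi_gt0 hphi (s_of_le x y) xr0). Qed.
Let T_gt0 : 0 < T. Proof. exact: (phi_regular hphi (s_of_le x y) xr0). Qed.

Lemma det_metric_tensor : \det (metric_tensor F x y) = p ^+ 3 * T.
Proof.
have [c [d [w [[yc yd] cd [xc xd] w0 Nw]]]] := orthonormal_coords xy.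
rewrite det_mx2 !metric_tensorE /T /regularity_term /mu Nw.
by rewrite /= xc xd yc yd -/r -/s -/u -/p -/p1 -/p2; field: cd; rewrite u0.
Qed.

Lemma m_vecE (i : 'I_2) : m_vec phi x y i =
  a / (p ^+ 2 * T) * (p * n_covec x y i - p1 * N * y 0 i / u).
Proof.
have [c [d [w [[yc yd] cd [xc xd] w0 Nw]]]] := orthonormal_coords xy.
have pn0 : p != 0 by rewrite gt_eqF.
have Tn0 := T_gt0; move/lt0r_neq0: Tn0 => Tn0.
apply: (raise_index_unique
  (v := fun i => a / (p ^+ 2 * T) * (p * n_covec x y i - p1 * N * y 0 i / u))).
  by rewrite det_metric_tensor mulf_neq0 ?expf_neq0.
have sum2 (f : 'I_2 -> R) : \sum_(k < 2) f k = f 0 + f 1.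
  by rewrite big_ord_recl big_ord1; congr (_ + f _); apply: val_inj.
(* The regularity term is expanded with [w ^+ 2] for [N], to match the denominator that [field] will
   meet. *)
move: Tn0; rewrite /T /regularity_term /N Nw -/p -/p1 -/p2 -/s => Tn0.
apply: ord2P; rewrite sum2 !metric_tensorE /m_covec /n_covec /mu -/a -/s -/u;
  rewrite /= xc xd yc yd -/s -/u; field: cd; by rewrite ?pn0 ?u0 ?Tn0.
Qed.

Lemma sqr_diff_gt0 : 0 < N.
Proof.
have [c [d [w [_ _ _ w0 Nw]]]] := orthonormal_coords xy.
by rewrite /N Nw exprn_even_gt0.
Qed.

Let pT_gt0 : 0 < p * T / N.
Proof. by rewrite divr_gt0 ?sqr_diff_gt0 ?mulr_gt0. Qed.

Lemma frame_coef_gt0 : 0 < a.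
Proof. by rewrite sqrtr_gt0. Qed.

Lemma sqr_frame_coef : a ^+ 2 = p * T / N.
Proof. by rewrite sqr_sqrtr ?ltW. Qed.

(** Pythagoras: [n] and [y] are orthogonal and [n] has squared length [N], so the cross term
    vanishes. *)
Lemma sqr_m_vec : m_vec phi x y 0 ^+ 2 + m_vec phi x y 1 ^+ 2 =
  a ^+ 2 / (p ^+ 4 * T ^+ 2) * (p ^+ 2 * N + p1 ^+ 2 * N ^+ 2).
Proof.
have [c [d [w [[yc yd] cd [xc xd] w0 Nw]]]] := orthonormal_coords xy.
have /lt0r_neq0 pn0 := p_gt0; have /lt0r_neq0 Tn0 := T_gt0.
rewrite !m_vecE /n_covec /N Nw xc xd yc yd -/s -/u; field: cd.
by rewrite pn0 u0 Tn0.
Qed.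

(* The factor [p - s * p1] cancels. *)
Lemma rho2D_rho3 : rho2 phi r s + s * rho3 phi r s = - p1 / (p ^+ 2 * T).
Proof.
have /lt0r_neq0 pn0 := p_gt0; have /lt0r_neq0 Tn0 := T_gt0.
have /lt0r_neq0 kn0 := surface_coef_gt0 hphi (s_of_le x y) xr0.
rewrite /rho2 /rho3 -/T -/p -/p1 -/p2; field.
by rewrite pn0 Tn0 kn0.
Qed.

(** The Cartan formula and [m = a n] show that this value works for all components; conversely, one
    component [(i, i, i)] with [n_i] nonzero already determines [I]. *)
Lemma main_scalarP (I : R) : is_main_scalar phi x y I <->
  I = p / (2 * a ^+ 3) * (nu + 3 * mu / N).
Proof.
have /lt0r_neq0 an0 := frame_coef_gt0; have /lt0r_neq0 Nn0 := sqr_diff_gt0.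
have FE : spherical_metric phi x y = u * p by [].
split=> [mI|-> i j k]; last first.
  rewrite FE cartan_tensorE /m_covec -/a; field.
  by rewrite an0 Nn0 u0.
have [i ni0] : exists i, n_covec x y i != 0.
  have [c [d [w [[yc yd] cd [xc xd] w0 Nw]]]] := orthonormal_coords xy.
  (* Since [n = w (d, -c)] with [(c, d)] a unit vector, index 1 serves when [d] vanishes and index 0
     otherwise. *)
  have [d0|d0] := eqVneq d 0.
    exists 1; have -> : n_covec x y 1 = - (w * c).
      by rewrite /n_covec xd yd -/s -/u; field.
    rewrite oppr_eq0 mulf_neq0//; apply: contra_eq_neq cd => ->.
    by rewrite d0 !expr0n subr0 eq_sym oner_eq0.
  exists 0; have -> : n_covec x y 0 = w * d.
    by rewrite /n_covec xc yc -/s -/u; field.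
  by rewrite mulf_neq0.
have an3 : (a * n_covec x y i) ^+ 3 != 0 by rewrite expf_neq0 ?mulf_neq0.
apply: (mulIf an3).
transitivity (I * m_covec phi x y i * m_covec phi x y i * m_covec phi x y i).
  by rewrite /m_covec -/a; ring.
rewrite -mI FE cartan_tensorE; field.
by rewrite an0 Nn0 u0.
Qed.

End MainScalar.

(** * Rewriting the main scalar through the frame vector and [B] *)

Theorem theorem3 (R : realType) (r0 : R) (phi : R -> R -> R)
    (hphi : spherically_symmetric_surface r0 phi)
    (x y : 'rV[R]_2) (hx : enorm x < r0) (hxy : free [:: x; y]) (I : R) :
  let r := enorm x in
  let s := s_of x y in
  let p := phi r s in
  let p_s := phi_s phi r s in
  let p_ss := phi_ss phi r s in
  let p_sss := phi_sss phi r s in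
  let a := frame_coef phi r s in
  let m := m_vec phi x y in
  let B := rho2 phi r s + s * rho3 phi r s in
  let mu := p * p_s - s * p_s ^+ 2 - s * p * p_ss in
  let nu := 3 * p_s * p_ss + p * p_sss in
  is_main_scalar phi x y I <->
  I = p / 2 * (3 * mu / a * (m 0 ^+ 2 + m 1 ^+ 2)
               - 3 * a * mu * (r ^+ 2 - s ^+ 2) ^+ 2 * B ^+ 2
               + nu / a ^+ 3).
Proof.
move=> r s p p_s p_ss p_sss a m B mu nu.
have /lt0r_neq0 pn0 := phi_gt0 hphi (s_of_le x y) hx.
have /lt0r_neq0 Tn0 := phi_regular hphi (s_of_le x y) hx.
have /lt0r_neq0 an0 := frame_coef_gt0 hphi hx hxy.
have /lt0r_neq0 Nn0 := sqr_diff_gt0 hxy.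
have aE := sqr_frame_coef hphi hx hxy.
rewrite (main_scalarP hphi hx hxy) /m (sqr_m_vec hphi hx hxy)
  /B (rho2D_rho3 hphi y hx).
rewrite -/r -/s -/p -/p_s -/p_ss -/p_sss -/a -/mu -/nu.
rewrite -/r -/s -/p -/a in pn0 Tn0 an0 Nn0 aE.
set T := regularity_term phi r s in Tn0 aE *.
set N := r ^+ 2 - s ^+ 2 in Nn0 aE *.
suff -> : p / (2 * a ^+ 3) * (nu + 3 * mu / N) =
  p / 2 * (3 * mu / a * (a ^+ 2 / (p ^+ 4 * T ^+ 2)
                          * (p ^+ 2 * N + p_s ^+ 2 * N ^+ 2))
   - 3 * a * mu * N ^+ 2 * (- p_s / (p ^+ 2 * T)) ^+ 2 + nu / a ^+ 3) by [].
(* [T] enters only through its square, so this relation eliminates it; the [B] term then cancels the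
   contribution of the [y] component of [m]. *)
have a4 : a ^+ 4 * N ^+ 2 = p ^+ 2 * T ^+ 2.
  by rewrite (exprM a 2 2) aE; field.
rewrite expr_div_n exprMn.
have -> : T ^+ 2 = a ^+ 4 * N ^+ 2 / p ^+ 2 by rewrite a4; field.
by field; rewrite pn0 an0 Nn0.
Qed.
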